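(* Let $k,\rho,c,\ell,\gamma,q_0>0$ and $0<\varepsilon<1$ be real constants and let $\alpha=\frac{k}{\rho c}$. Suppose that $q_0>\sqrt{\frac{\gamma(1-\varepsilon)\rho\ell k}{2}}$. Let $D_0>0$ be the datum associated with $q_0$ as in the context, and let $\xi>0$ be the coefficient of the solid–mushy zone interface $s(t)=2\xi\sqrt{\alpha t}$ of Problem $(P_2)$ with datum $D_0$. Then $$\operatorname{erf}(\xi)<D_0\sqrt{\frac{2c}{\pi\gamma(1-\varepsilon)\ell}}.$$
   Context: $\operatorname{erf}(x)=\frac{2}{\sqrt{\pi}}\int_0^x e^{-u^2}\,du$. Problem $(P_2)$ with datum $D_0>0$: find $(T,s,r)$ with $s(t)<r(t)$ for $t>0$ such that $T_t-\alpha T_{xx}=0$ for $0<x<s(t)$, $t>0$; $T(s(t),t)=0$; $kT_x(s(t),t)=\rho\ell[\varepsilon\dot s(t)+(1-\varepsilon)\dot r(t)]$; $T_x(s(t),t)(r(t)-s(t))=\gamma$ for $t>0$; $s(0)=r(0)=0$; and $T(0,t)=-D_0$ for $t>0$. Its (known) solution has $s(t)=2\xi\sqrt{\alpha t}$, where $\xi>0$ is the unique positive solution of $$\frac{1}{F_\infty(x)}\left[x+\frac{\gamma(1-\varepsilon)\sqrt{\pi}}{2D_0}\frac{1}{F_\infty(x)}\right]=\frac{D_0c}{\ell\sqrt{\pi}},\qquad F_\infty(x)=\frac{e^{-x^2}}{\operatorname{erf}(x)}.$$ Datum associated with $q_0$: under the stated inequality on $q_0$, let $\omega>0$ be the unique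 positive solution of $\left[x+\frac{\gamma(1-\varepsilon)k}{2q_0\sqrt{\alpha}}e^{x^2}\right]e^{x^2}=\frac{q_0}{\rho\ell\sqrt{\alpha}}$; then $D_0=\frac{q_0\sqrt{\pi\alpha}}{k}\operatorname{erf}(\omega)$. (This is the datum for which Problem $(P_2)$ is equivalent to the same problem with $T(0,t)=-D_0$ replaced by $kT_x(0,t)=\frac{q_0}{\sqrt t}$.) *)

(* Defs.v *)
From Stdlib Require Import Reals.
From Coquelicot Require Import Coquelicot.
Open Scope R_scope.

Definition erf (x : R) : R :=
  2 / sqrt PI * RInt (fun u => exp (- u ^ 2)) 0 x.

(* Left derivative: the meaning given to [T_x(s(t),t)], since the temperature
   is only prescribed on the solid side [x <= s(t)] of the interface. *)
Definition is_left_derive (f : R -> R) (a l : R) : Prop :=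
  filterlim (fun x => (f x - f a) / (x - a)) (at_left a) (locally l).

Definition solid (s : R -> R) (p : R * R) : Prop :=
  0 < snd p /\ 0 <= fst p <= s (snd p).

(* Classical solutions [(T, s, r)] of the two-free-boundary problem with
   temperature datum [D0] at the fixed face. The arguments of [T] are the
   position and then the time; its values outside [solid s] play no role.
   No regularity of [T] is required at the corner [(0, 0)], where the boundary
   data are incompatible. *)
Record solves_P2 (k rho c ell gamma eps D0 : R)
    (T : R -> R -> R) (s r : R -> R) : Prop := {
  P2_order : forall t, 0 < t -> s t < r t;
  P2_s0 : s 0 = 0;
  P2_r0 : r 0 = 0;
  P2_s_cont0 : filterlim s (at_right 0) (locally (s 0));
  P2_r_cont0 : filterlim r (at_right 0) (locally (r 0));
  P2_s_diff : forall t, 0 < t -> ex_derive s t;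
  P2_r_diff : forall t, 0 < t -> ex_derive r t;
  P2_T_cont : forall x t, solid s (x, t) ->
    filterlim (fun p : R * R => T (fst p) (snd p))
      (within (solid s) (locally (x, t))) (locally (T x t));
  P2_T_diff : forall x t, 0 < t -> 0 < x < s t ->
    ex_derive (fun u => T x u) t /\
    ex_derive (fun y => T y t) x /\
    ex_derive (Derive (fun y => T y t)) x;
  P2_heat : forall x t, 0 < t -> 0 < x < s t ->
    Derive (fun u => T x u) t
    - k / (rho * c) * Derive (Derive (fun y => T y t)) x = 0;
  P2_interface : forall t, 0 < t -> T (s t) t = 0;
  P2_flux : forall t, 0 < t -> exists Tx : R,
    is_left_derive (fun y => T y t) (s t) Tx /\
    k * Tx = rho * ell * (eps * Derive s t + (1 - eps) * Derive r t) /\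
    Tx * (r t - s t) = gamma;
  P2_fixed_face : forall t, 0 < t -> T 0 t = - D0
}.

Definition omega_equation (k rho c ell gamma eps q0 x : R) : Prop :=
  let alpha := k / (rho * c) in
  (x + gamma * (1 - eps) * k / (2 * q0 * sqrt alpha) * exp (x ^ 2))
    * exp (x ^ 2)
  = q0 / (rho * ell * sqrt alpha).

Definition is_datum_of_flux (k rho c ell gamma eps q0 D0 : R) : Prop :=
  exists omega : R,
    unique (fun x => 0 < x /\ omega_equation k rho c ell gamma eps q0 x) omega
    /\ D0 = q0 * sqrt (PI * (k / (rho * c))) / k * erf omega.

(* Main.v *)
(** Since [s(t) = L sqrt t], the difference between [T] and the similarity
    solution [D0 erf(x / (2 sqrt(a t))) / erf xi - D0] solves the heat equation
    with zero data on both lateral boundaries. It may be singular at the corner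
    [(0, 0)], so it need not vanish; but the parabolic maximum principle on
    [t >= 1], with a barrier decaying like [t^(-lam)], shows that its flux at
    the interface is [o(1 / sqrt t)] as [t] tends to infinity. Hence
    [sqrt t T_x(s(t),t)] tends to the flux [h] of the similarity solution,
    [(r - s) / sqrt t] tends to [gamma / h], and the flux condition gives the
    limit of [sqrt t r'(t)], which must be half the limit of [r(t) / sqrt t].
    This is the equation for [xi]. The equation for [omega] is the same one, and
    it has a single positive solution, so [xi = omega]; the inequality then
    reduces to the lower bound on [q0]. *)

Require Import Defs.
From Stdlib Require Import Reals Lra ClassicalEpsilon.
From Coquelicot Require Import Coquelicot.
Open Scope R_scope.

(** * The parabolic maximum principle *)

(** Maximise along each horizontal segment first. The maximiser [X y] is picked by choice and may
    jump, but the value [V (X y, y)] is continuous in [y] by uniform continuity of [V], so it has a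
    maximum over [y]. *)
Lemma continuous_rectangle_maximum (V : R * R -> R) (a b c d : R) :
  a <= b -> c <= d -> (forall p, continuous V p) ->
  exists x y, a <= x <= b /\ c <= y <= d /\
    forall x' y', a <= x' <= b -> c <= y' <= d -> V (x', y') <= V (x, y).
Proof.
  intros hab hcd hV.
  assert (hc : forall x y, continuity_2d_pt (fun x y => V (x, y)) x y).
  { intros x y; apply continuity_2d_pt_filterlim.
    apply filterlim_ext with V; [intros [u v]; reflexivity | apply hV]. }
  assert (hrow : forall y, exists x, (forall x', a <= x' <= b -> V (x', y) <= V (x, y)) /\ a <= x <= b).
  { intros y; apply (continuity_ab_maj (fun x => V (x, y))); [exact hab|].
    intros x _; apply continuity_pt_locally; intros e.
    destruct (hc x y e) as [del hdel]; exists del; intros z hz; apply hdel; [exact hz|].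
    rewrite Rminus_diag, Rabs_R0; apply cond_pos. }
  pose (X := fun y => proj1_sig (constructive_indefinite_description _ (hrow y))).
  assert (hX : forall y, (forall x', a <= x' <= b -> V (x', y) <= V (X y, y)) /\ a <= X y <= b)
    by (intros y; exact (proj2_sig (constructive_indefinite_description _ (hrow y)))).
  destruct (continuity_ab_maj (fun y => V (X y, y)) c d hcd) as [y [hy1 hy2]].
  - intros y hy; apply continuity_pt_locally; intros e.
    destruct (uniform_continuity_2d (fun x y => V (x, y)) a b (y - 1) (y + 1)
      (fun x y _ _ => hc x y) e) as [del hdel].
    assert (h1 : 0 < Rmin del 1) by (apply Rmin_pos; [apply cond_pos | lra]).
    exists (mkposreal _ h1); intros z hz; change R in z.
    assert (hz' : Rabs (z - y) < Rmin del 1) by exact hz.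
    pose proof (Rmin_l del 1); pose proof (Rmin_r del 1).
    assert (hzy : Rabs (z - y) < 1) by lra; apply Rabs_def2 in hzy.
    destruct (hX z) as [hz1 hz2]; destruct (hX y) as [hy1 hy2].
    assert (H1 : Rabs (V (X y, z) - V (X y, y)) < e).
    { apply hdel; try lra; rewrite Rminus_diag, Rabs_R0; apply cond_pos. }
    assert (H2 : Rabs (V (X z, z) - V (X z, y)) < e).
    { apply hdel; try lra; rewrite Rminus_diag, Rabs_R0; apply cond_pos. }
    apply Rabs_def2 in H1; apply Rabs_def2 in H2.
    (* Each row maximum dominates the value of its own row at the other row's maximiser. With [H1]
       and [H2] this bounds the difference of the two maxima on both sides. *)
    specialize (hz1 (X y) hy2); specialize (hy1 (X z) hz2).
    apply Rabs_def1; lra.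
  - exists (X y), y; repeat split; try apply hX; try apply hy2.
    intros x' y' hx' hy'; apply Rle_trans with (V (X y', y')).
    + now apply hX.
    + now apply hy1.
Qed.

Lemma continuous_pair {U V W : UniformSpace} (f : U -> V) (g : U -> W) (x : U) :
  continuous f x -> continuous g x -> continuous (fun z => (f z, g z)) x.
Proof.
  intros hf hg; apply filterlim_locally; intros e.
  apply filterlim_locally with (eps := e) in hf.
  apply filterlim_locally with (eps := e) in hg.
  generalize (filter_and _ _ hf hg); apply filter_imp; intros z [h1 h2]; split; assumption.
Qed.

(** For [a <= b], a continuous retraction of the line onto [[a, b]]. Composing with it turns
    functions continuous only within a closed set into continuous functions on the whole space. *)
Definition clamp (a b x : R) := Rmax a (Rmin b x).

Lemma clamp_range a b x : a <= b -> a <= clamp a b x <= b.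
Proof.
  intros h; unfold clamp; split; [apply Rmax_l|].
  apply Rmax_lub; [exact h | apply Rmin_l].
Qed.

Lemma clamp_id a b x : a <= x <= b -> clamp a b x = x.
Proof. intros h; unfold clamp; rewrite Rmin_right, Rmax_right; lra. Qed.

Lemma clamp_continuous a b x : continuous (clamp a b) x.
Proof.
  apply continuity_pt_filterlim, continuity_pt_locally; intros e.
  exists e; intros y hy.
  assert (hy' : Rabs (y - x) < e) by exact hy.
  apply Rle_lt_trans with (2 := hy').
  unfold clamp, Rmax, Rmin, Rabs; repeat destruct Rle_dec; repeat destruct Rcase_abs; lra.
Qed.

Lemma derive_pos_right (p : R -> R) (x q : R) :
  is_derive p x q -> 0 < q -> exists d, 0 < d /\ forall y, x < y < x + d -> p x < p y.
Proof.
  intros hp hq; apply is_derive_Reals in hp.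
  destruct (hp (q / 2) ltac:(lra)) as [d hd].
  exists d; split; [apply cond_pos|]; intros y hy.
  specialize (hd (y - x) ltac:(lra) ltac:(rewrite Rabs_right; lra)).
  replace (x + (y - x)) with y in hd by ring.
  apply Rabs_def2 in hd.
  assert (h : 0 < (p y - p x) / (y - x)) by lra.
  apply Rmult_lt_compat_r with (r := y - x) in h; [|lra].
  unfold Rdiv in h; rewrite Rmult_assoc, Rinv_l in h; lra.
Qed.

(** Used in the time variable, where the maximum may occur at the final time and only earlier times
    can be compared. The reflection [y -> - y] reduces it to [derive_pos_right]. *)
Lemma derive_nonneg_at_left_maximum (f : R -> R) (x l c : R) :
  is_derive f x l -> c < x -> (forall y, c <= y <= x -> f y <= f x) -> 0 <= l.
Proof.
  intros hf hc hmax; destruct (Rle_or_lt 0 l) as [h|h]; [exact h|].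
  assert (hg : is_derive (fun y => f (- y)) (- x) (- l)).
  { replace (- l) with (-1 * l) by ring.
    apply (is_derive_comp f (fun y => - y)); [now rewrite Ropp_involutive|].
    auto_derive; [exact I | ring]. }
  destruct (derive_pos_right _ _ _ hg ltac:(lra)) as [d [hd hd']].
  pose (m := Rmin (d / 2) (x - c)).
  assert (0 < m) by (apply Rmin_pos; lra).
  pose proof (Rmin_l (d / 2) (x - c)); pose proof (Rmin_r (d / 2) (x - c)).
  fold m in H0, H1.
  specialize (hd' (- x + m) ltac:(lra)); cbv beta in hd'.
  rewrite Ropp_involutive in hd'.
  specialize (hmax (- (- x + m)) ltac:(lra)); lra.
Qed.

(** At the maximum [p x = 0]. If [q] were positive, [p] would be positive just to the right of [x],
    and the mean value theorem would give a larger value of [f] there. *)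
Lemma second_derivative_nonpos_at_maximum (f p : R -> R) (a b x q : R) :
  a < x < b -> (forall y, a < y < b -> f y <= f x) ->
  locally x (fun y => is_derive f y (p y)) -> is_derive p x q -> q <= 0.
Proof.
  intros hx hmax [e he] hp; destruct (Rle_or_lt q 0) as [h|h]; [exact h|].
  assert (hpx : p x = 0).
  { assert (hd := he x (ball_center x e)); apply is_derive_Reals in hd.
    rewrite <- (derive_pt_eq_0 f x (p x) (exist _ (p x) hd) hd).
    apply (deriv_maximum f a b); try lra; intros y h1 h2; apply hmax; lra. }
  destruct (derive_pos_right p x q hp h) as [d [hd hd']].
  pose (m := Rmin (Rmin (d / 2) (e / 2)) ((b - x) / 2)).
  pose proof (cond_pos e).
  assert (0 < m) by (repeat apply Rmin_pos; lra).
  assert (m <= d / 2 /\ m <= e / 2 /\ m <= (b - x) / 2) as (hm1 & hm2 & hm3).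
  { unfold m, Rmin; repeat destruct Rle_dec; lra. }
  assert (hball : forall y, x <= y <= x + m -> is_derive f y (p y)).
  { intros y hy; apply he; change (Rabs (y - x) < e); rewrite Rabs_right; lra. }
  destruct (MVT_cor2 f p x (x + m)) as [c [hc1 hc2]]; [lra | |].
  { intros y hy; apply is_derive_Reals, hball; exact hy. }
  specialize (hd' c ltac:(lra)); specialize (hmax (x + m) ltac:(lra)).
  assert (0 < p c * (x + m - x)) by (apply Rmult_lt_0_compat; lra).
  lra.
Qed.

(** The differential inequality is strict, so no perturbation of [W] is required: at a maximum off
    the bottom and the lateral sides, [wt >= 0] and [q <= 0] contradict [wt - a * q < 0]. The final
    time [d] counts as interior. *)
Lemma parabolic_maximum_principle (a c d : R) (s : R -> R) (W : R -> R -> R)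
  (D := fun p : R * R => c <= snd p <= d /\ 0 <= fst p <= s (snd p)) :
  0 <= a ->
  (forall t, c <= t <= d -> continuous s t) ->
  (forall t, c <= t <= d -> 0 <= s t) ->
  (forall x t, D (x, t) -> filterlim (fun p => W (fst p) (snd p))
     (within D (locally (x, t))) (locally (W x t))) ->
  (forall x t, c < t <= d -> 0 < x < s t -> exists (wt : R) (p : R -> R) (q : R),
     is_derive (fun u => W x u) t wt /\
     locally x (fun y => is_derive (fun z => W z t) y (p y)) /\
     is_derive p x q /\ wt - a * q < 0) ->
  (forall x, 0 <= x <= s c -> W x c <= 0) ->
  (forall t, c <= t <= d -> W 0 t <= 0) ->
  (forall t, c <= t <= d -> W (s t) t <= 0) ->
  forall x t, c <= t <= d -> 0 <= x <= s t -> W x t <= 0.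
Proof.
  intros ha hsc hs hW hin hbot hleft hright x0 t0 ht0 hx0.
  (* [Phi] maps the plane continuously onto the closed domain [D], where [W] is
     only known to be continuous from within. *)
  pose (Phi := fun p : R * R => (clamp 0 1 (fst p) * s (clamp c d (snd p)), clamp c d (snd p))).
  assert (hcd : c <= d) by lra.
  assert (hPhiD : forall p, D (Phi p)).
  { intros [y t]; unfold Phi, D; simpl.
    pose proof (clamp_range c d t hcd) as h1; split; [exact h1|].
    pose proof (hs _ h1); pose proof (clamp_range 0 1 y ltac:(lra)) as h2.
    split; [apply Rmult_le_pos; lra|].
    rewrite <- (Rmult_1_l (s _)) at 2; apply Rmult_le_compat_r; lra. }
  assert (hPhic : forall p, continuous Phi p).
  { intros [y t].
    assert (ct : continuous (fun p : R * R => clamp c d (snd p)) (y, t)).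
    { apply (continuous_comp (fun p : R * R => snd p) (clamp c d)); [apply continuous_snd | apply clamp_continuous]. }
    assert (cs : continuous (fun p : R * R => s (clamp c d (snd p))) (y, t)).
    { apply (continuous_comp (fun p : R * R => clamp c d (snd p)) s); [exact ct|].
      apply hsc, clamp_range, hcd. }
    assert (cy : continuous (fun p : R * R => clamp 0 1 (fst p)) (y, t)).
    { apply (continuous_comp (fun p : R * R => fst p) (clamp 0 1)); [apply continuous_fst | apply clamp_continuous]. }
    assert (cm := continuous_mult _ _ _ cy cs).
    exact (continuous_pair _ _ _ cm ct). }
  assert (hV : forall p, continuous (fun p => W (fst (Phi p)) (snd (Phi p))) p).
  { intros p.
    assert (h := hW (fst (Phi p)) (snd (Phi p))).
    rewrite <- surjective_pairing in h.
    apply (filterlim_comp _ _ _ Phi (fun q => W (fst q) (snd q)) _ (within D (locally (Phi p)))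
      _); [|exact (h (hPhiD p))].
    intros P hP; unfold filtermap, within in *.
    apply (filter_imp (fun z => D (Phi z) -> P (Phi z)));
      [intros z hz; apply hz, hPhiD | exact (hPhic p _ hP)]. }
  destruct (continuous_rectangle_maximum _ 0 1 c d ltac:(lra) hcd hV) as [y [t [hy [ht hmax]]]].
  set (x := y * s t).
  assert (hPhi : forall y t, 0 <= y <= 1 -> c <= t <= d -> Phi (y, t) = (y * s t, t)).
  { intros y' t' h1 h2; unfold Phi; simpl; rewrite !clamp_id; auto. }
  (* Surjectivity of [Phi] onto [D]: the preimage has first coordinate [x' / s t'], except where
     [s t' = 0] and the row collapses to the point [0]. *)
  assert (hM : forall x' t', c <= t' <= d -> 0 <= x' <= s t' -> W x' t' <= W x t).
  { intros x' t' h1 h2; destruct (Req_dec (s t') 0) as [h0|h0].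
    - specialize (hmax 0 t' ltac:(lra) h1); rewrite !hPhi in hmax by (auto; lra).
      simpl in hmax; rewrite h0 in hmax; replace x' with (0 * 0) by lra; exact hmax.
    - assert (hy' : 0 <= x' / s t' <= 1).
      { split; [apply Rdiv_le_0_compat; lra|].
        apply Rmult_le_reg_r with (s t'); [lra|].
        unfold Rdiv; rewrite Rmult_assoc, Rinv_l; lra. }
      specialize (hmax (x' / s t') t' hy' h1); rewrite !hPhi in hmax by auto.
      simpl in hmax; replace (x' / s t' * s t') with x' in hmax by (field; exact h0).
      exact hmax. }
  apply Rle_trans with (W x t); [apply hM; assumption|].
  pose proof (hs t ht) as hst.
  assert (hx : 0 <= x <= s t).
  { unfold x; split; [apply Rmult_le_pos; lra|].
    rewrite <- (Rmult_1_l (s t)) at 2; apply Rmult_le_compat_r; lra. }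
  destruct (Req_dec t c) as [->|htc]; [now apply hbot|].
  destruct (Req_dec x 0) as [->|hx0']; [now apply hleft|].
  destruct (Req_dec x (s t)) as [hxs|hxs]; [rewrite hxs; now apply hright|].
  exfalso.
  destruct (hin x t ltac:(lra) ltac:(lra)) as (wt & p & q & h1 & h2 & h3 & h4).
  assert (q <= 0).
  { apply (second_derivative_nonpos_at_maximum (fun z => W z t) p 0 (s t) x); auto; [lra|].
    intros z hz; apply hM; lra. }
  (* Since [x < s t] and [s] is continuous, the vertical segment just below [(x, t)] stays in the
     domain, so earlier times at the same [x] can be compared. *)
  assert (hloc : exists c', c < c' < t /\ forall u, c' <= u <= t -> x <= s u).
  { assert (hc := hsc t ht).
    assert (hP : locally (s t) (fun z => x < z)) by (apply open_gt; lra).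
    destruct (hc _ hP) as [e he]; pose proof (cond_pos e).
    exists (Rmax (t - e / 2) ((c + t) / 2)).
    assert (h5 : t - e / 2 <= Rmax (t - e / 2) ((c + t) / 2)) by apply Rmax_l.
    assert (h6 : (c + t) / 2 <= Rmax (t - e / 2) ((c + t) / 2)) by apply Rmax_r.
    assert (Rmax (t - e / 2) ((c + t) / 2) < t) by (apply Rmax_lub_lt; lra).
    split; [lra|].
    intros u hu; apply Rlt_le, he; change (Rabs (u - t) < e); apply Rabs_def1; lra. }
  destruct hloc as [c' [hc' hc'']].
  assert (0 <= wt).
  { apply (derive_nonneg_at_left_maximum (fun u => W x u) t wt c'); auto; [lra|].
    intros u hu; apply hM; [lra|]; specialize (hc'' u hu); lra. }
  assert (0 <= a * (- q)) by (apply Rmult_le_pos; lra); lra.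
Qed.

(** * The error function and similarity solutions *)

Lemma filterlim_Rminus {T : Type} {F : (T -> Prop) -> Prop} {FF : Filter F}
  (f g : T -> R) (l m : R) :
  filterlim f F (locally l) -> filterlim g F (locally m) ->
  filterlim (fun x => f x - g x) F (locally (l - m)).
Proof.
  intros hf hg; apply (filterlim_comp_2 (G := locally l) (H := locally (- m)) f (fun x => - g x) Rplus).
  - exact hf.
  - apply (filterlim_comp _ _ _ g Ropp _ (locally m)); [exact hg|].
    apply (filterlim_opp (V := R_NormedModule)).
  - apply (filterlim_plus (V := R_NormedModule)).
Qed.

Lemma is_derive_Rminus (f g : R -> R) (x l m : R) :
  is_derive f x l -> is_derive g x m -> is_derive (fun y => f y - g y) x (l - m).
Proof. intros hf hg; exact (is_derive_minus f g x l m hf hg). Qed.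

Lemma exp_neg_sq_continuous x : continuous (fun u => exp (- u ^ 2)) x.
Proof. apply (ex_derive_continuous (fun u => exp (- u ^ 2))); auto_derive; exact I. Qed.

Lemma is_derive_erf x : is_derive erf x (2 / sqrt PI * exp (- x ^ 2)).
Proof.
  unfold erf; apply is_derive_scal.
  apply (is_derive_RInt (fun u => exp (- u ^ 2)) _ 0); [|apply exp_neg_sq_continuous].
  apply filter_forall; intros y; apply (@RInt_correct R_CompleteNormedModule).
  apply (@ex_RInt_continuous R_CompleteNormedModule); intros z _; apply exp_neg_sq_continuous.
Qed.

Lemma erf_0 : erf 0 = 0.
Proof. unfold erf; rewrite RInt_point; apply Rmult_0_r. Qed.

Lemma erf_increasing x y : x < y -> erf x < erf y.
Proof.
  intros h.
  destruct (MVT_cor2 erf (fun u => 2 / sqrt PI * exp (- u ^ 2)) x y h) as [z [hz _]].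
  { intros z _; apply is_derive_Reals, is_derive_erf. }
  assert (0 < 2 / sqrt PI * exp (- z ^ 2) * (y - x)); [|lra].
  repeat apply Rmult_lt_0_compat; try apply exp_pos; try lra.
  apply Rinv_0_lt_compat, sqrt_lt_R0, PI_RGT_0.
Qed.

Lemma erf_pos x : 0 < x -> 0 < erf x.
Proof. intros h; rewrite <- erf_0; now apply erf_increasing. Qed.

Lemma erf_similarity_x (a t x : R) : 0 < a -> 0 < t ->
  is_derive (fun y => erf (y / (2 * sqrt (a * t)))) x
    (exp (- (x / (2 * sqrt (a * t))) ^ 2) / sqrt (PI * (a * t))).
Proof.
  intros ha ht; assert (hat : 0 < a * t) by now apply Rmult_lt_0_compat.
  pose proof (sqrt_lt_R0 _ hat); pose proof (sqrt_lt_R0 _ PI_RGT_0).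
  rewrite (sqrt_mult PI (a * t)) by (pose proof PI_RGT_0; lra).
  replace (exp (- (x / (2 * sqrt (a * t))) ^ 2) / (sqrt PI * sqrt (a * t)))
    with (1 / (2 * sqrt (a * t)) * (2 / sqrt PI * exp (- (x / (2 * sqrt (a * t))) ^ 2)))
    by (field; split; lra).
  apply (is_derive_comp erf (fun y => y / (2 * sqrt (a * t)))); [apply is_derive_erf|].
  auto_derive; [exact I|]; field; lra.
Qed.

Lemma erf_similarity_xx (a t x : R) : 0 < a -> 0 < t ->
  is_derive (fun y => exp (- (y / (2 * sqrt (a * t))) ^ 2) / sqrt (PI * (a * t))) x
    (- x / (2 * (a * t)) * exp (- (x / (2 * sqrt (a * t))) ^ 2) / sqrt (PI * (a * t))).
Proof.
  intros ha ht; assert (hat : 0 < a * t) by now apply Rmult_lt_0_compat.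
  assert (hs := sqrt_lt_R0 _ hat).
  assert (h : 0 < sqrt (PI * (a * t)))
    by (apply sqrt_lt_R0, Rmult_lt_0_compat; [apply PI_RGT_0 | exact hat]).
  assert (e : a * t = sqrt (a * t) * sqrt (a * t)) by (rewrite sqrt_sqrt; lra).
  replace (- x / (2 * (a * t))) with (- x / (2 * (sqrt (a * t) * sqrt (a * t))))
    by (now rewrite <- e).
  auto_derive; [exact I|].
  (* [auto_derive] writes the exponent in another, convertible form. Both exponentials are folded
     into one atom for [field]. *)
  set (E := exp (- (x / _) ^ 2)).
  match goal with |- context [exp ?v] => change (exp v) with E end.
  field; lra.
Qed.

(** The value is displayed as [a] times that of [erf_similarity_xx], so the two lemmas together give
    the heat equation. *)
Lemma erf_similarity_t (a t x : R) : 0 < a -> 0 < t ->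
  is_derive (fun u => erf (x / (2 * sqrt (a * u)))) t
    (a * (- x / (2 * (a * t)) * exp (- (x / (2 * sqrt (a * t))) ^ 2) / sqrt (PI * (a * t)))).
Proof.
  intros ha ht; assert (hat : 0 < a * t) by now apply Rmult_lt_0_compat.
  assert (hs := sqrt_lt_R0 _ hat); pose proof (sqrt_lt_R0 _ PI_RGT_0).
  assert (e : a * t = sqrt (a * t) * sqrt (a * t)) by (rewrite sqrt_sqrt; lra).
  rewrite (sqrt_mult PI (a * t)) by (pose proof PI_RGT_0; lra).
  match goal with |- is_derive _ _ ?v => replace v
    with ((- x * a / (4 * (a * t) * sqrt (a * t))) *
          (2 / sqrt PI * exp (- (x / (2 * sqrt (a * t))) ^ 2))) by (field; repeat split; lra) end.
  apply (is_derive_comp erf (fun u => x / (2 * sqrt (a * u)))); [apply is_derive_erf|].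
  replace (4 * (a * t)) with (4 * (sqrt (a * t) * sqrt (a * t))) by (now rewrite <- e).
  auto_derive; [repeat split; lra|].
  field; lra.
Qed.

(** * Decay of the flux of solutions with zero boundary data *)

(* A strict supersolution of the heat equation [U_t = a U_xx] when
   [lam * L ^ 2 < 2 * a], vanishing on [x = L sqrt t]; the first factor is [t^(-lam)]. *)
Definition barrier (lam L x t : R) : R := exp (- lam * ln t) * (L ^ 2 - x ^ 2 / t).

Lemma barrier_x lam L x t : 0 < t ->
  is_derive (fun y => barrier lam L y t) x (exp (- lam * ln t) * (- 2 * x / t)).
Proof. intros ht; unfold barrier; auto_derive; [exact I | field; lra]. Qed.

Lemma barrier_xx lam x t : 0 < t ->
  is_derive (fun y => exp (- lam * ln t) * (- 2 * y / t)) x (exp (- lam * ln t) * (- 2 / t)).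
Proof. intros ht; auto_derive; [exact I | field; lra]. Qed.

Lemma barrier_t lam L x t : 0 < t ->
  is_derive (fun u => barrier lam L x u) t
    (exp (- lam * ln t) * (- lam / t * (L ^ 2 - x ^ 2 / t) + x ^ 2 / t ^ 2)).
Proof. intros ht; unfold barrier; auto_derive; [lra | field; lra]. Qed.

Lemma barrier_continuous lam L x t : 0 < t ->
  continuous (fun p : R * R => barrier lam L (fst p) (snd p)) (x, t).
Proof.
  intros ht; unfold barrier.
  assert (c1 : continuous (fun p : R * R => fst p) (x, t)) by apply continuous_fst.
  assert (c2 : forall g : R -> R, ex_derive g t -> continuous (fun p : R * R => g (snd p)) (x, t)).
  { intros g hg; apply (continuous_comp (fun p : R * R => snd p) g); [apply continuous_snd|].
    apply (ex_derive_continuous g); exact hg. }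
  apply (continuous_mult (K := R_AbsRing) (fun p : R * R => exp (- lam * ln (snd p)))).
  - apply (c2 (fun t => exp (- lam * ln t))); auto_derive; exact ht.
  - apply (continuous_minus (V := R_NormedModule) (fun _ => L ^ 2)); [apply continuous_const|].
    apply (continuous_mult (K := R_AbsRing) (fun p : R * R => fst p ^ 2)).
    + apply (continuous_comp (fun p : R * R => fst p) (fun y => y ^ 2)); [exact c1|].
      apply (ex_derive_continuous (fun y => y ^ 2)); auto_derive; exact I.
    + apply (c2 Rinv); auto_derive; lra.
Qed.

(** The maximum principle is applied to [U - C * barrier], whose strict inequality comes from the
    barrier. The barrier is [L ^ 2 - x ^ 2] at time 1, positive at [x = 0], and zero on the moving
    side. Starting at time 1 keeps away from the corner. *)
Lemma heat_solution_decay (a L lam C : R) (U : R -> R -> R) :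
  0 < a -> 0 < L -> 0 <= lam -> lam * L ^ 2 < 2 * a -> 0 < C ->
  (forall x t, 1 <= t -> 0 <= x <= L * sqrt t ->
    filterlim (fun p => U (fst p) (snd p))
     (within (fun p : R * R => 0 < snd p /\ 0 <= fst p <= L * sqrt (snd p)) (locally (x, t)))
     (locally (U x t))) ->
  (forall x t, 1 < t -> 0 < x < L * sqrt t -> exists (p : R -> R) (q : R),
     is_derive (fun u => U x u) t (a * q) /\
     locally x (fun y => is_derive (fun z => U z t) y (p y)) /\ is_derive p x q) ->
  (forall t, 1 <= t -> U 0 t = 0) ->
  (forall t, 1 <= t -> U (L * sqrt t) t = 0) ->
  (forall x, 0 <= x <= L -> U x 1 <= C * (L ^ 2 - x ^ 2)) ->
  forall x t, 1 <= t -> 0 <= x <= L * sqrt t -> U x t <= C * barrier lam L x t.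
Proof.
  intros ha hL hlam hlamL hC hcont heq h0 hs h1 x t ht hx.
  assert (hB : forall t, 0 < t -> 0 < exp (- lam * ln t)) by (intros; apply exp_pos).
  apply Rminus_le.
  apply (parabolic_maximum_principle a 1 t (fun t => L * sqrt t)
    (fun x t => U x t - C * barrier lam L x t)); try lra.
  - intros u hu; apply (ex_derive_continuous (fun t => L * sqrt t)); auto_derive; lra.
  - intros u hu; apply Rmult_le_pos; [lra | apply sqrt_pos].
  - intros y u [hu hy]; simpl in hu, hy.
    apply (filterlim_Rminus (fun p : R * R => U (fst p) (snd p))
      (fun p : R * R => C * barrier lam L (fst p) (snd p))).
    + eapply filterlim_filter_le_1; [|exact (hcont y u (proj1 hu) hy)].
      intros P hP; unfold within in *; revert hP; apply filter_imp.
      intros p hp [hp1 hp2]; apply hp; split; [lra | exact hp2].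
    + eapply filterlim_filter_le_1; [apply filter_le_within|].
      exact (continuous_mult (K := R_AbsRing) (fun _ => C) _ (y, u)
        (continuous_const _ _) (barrier_continuous lam L y u ltac:(lra))).
  - intros y u hu hy.
    destruct (heq y u ltac:(lra) hy) as (p & q & e1 & e2 & e3).
    exists (a * q - C * (exp (- lam * ln u) * (- lam / u * (L ^ 2 - y ^ 2 / u) + y ^ 2 / u ^ 2))),
      (fun z => p z - C * (exp (- lam * ln u) * (- 2 * z / u))),
      (q - C * (exp (- lam * ln u) * (- 2 / u))).
    split; [|split; [|split]].
    + apply (is_derive_Rminus (fun u => U y u)); [exact e1|].
      apply is_derive_scal, barrier_t; lra.
    + revert e2; apply filter_imp; intros z hz.
      apply (is_derive_Rminus (fun z => U z u)); [exact hz|].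
      apply is_derive_scal, barrier_x; lra.
    + apply (is_derive_Rminus p); [exact e3|].
      apply is_derive_scal, barrier_xx; lra.
    (* This product is the heat operator applied to [C * barrier]; the hypothesis
       [lam * L ^ 2 < 2 * a] makes its last factor positive. *)
    + assert (0 < C * (exp (- lam * ln u) / u) * (2 * a - lam * L ^ 2 + (1 + lam) * (y ^ 2 / u))).
      { repeat apply Rmult_lt_0_compat; try apply hB; try lra.
        - apply Rinv_0_lt_compat; lra.
        - assert (0 <= (1 + lam) * (y ^ 2 / u)); [|lra].
          apply Rmult_le_pos; [lra|]; apply Rdiv_le_0_compat; [apply pow2_ge_0 | lra]. }
      match goal with |- ?v < 0 => replace v with
       (- (C * (exp (- lam * ln u) / u) * (2 * a - lam * L ^ 2 + (1 + lam) * (y ^ 2 / u))))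
       by (field; lra) end.
      lra.
  - intros y hy; rewrite sqrt_1, Rmult_1_r in hy; specialize (h1 y hy).
    unfold barrier; rewrite ln_1, Rmult_0_r, exp_0, Rdiv_1_r, Rmult_1_l; lra.
  - intros u hu; rewrite h0 by lra; unfold barrier.
    assert (0 <= C * (exp (- lam * ln u) * L ^ 2)).
    { apply Rmult_le_pos; [lra|].
      apply Rmult_le_pos; [apply Rlt_le, exp_pos | apply pow2_ge_0]. }
    replace (L ^ 2 - 0 ^ 2 / u) with (L ^ 2) by (field; lra); lra.
  - intros u hu; rewrite hs by lra; unfold barrier.
    rewrite Rpow_mult_distr, pow2_sqrt by lra.
    replace (L ^ 2 - L ^ 2 * u / u) with 0 by (field; lra); lra.
Qed.

Lemma is_left_derive_minus (f g : R -> R) (a l m : R) :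
  is_left_derive f a l -> is_left_derive g a m ->
  is_left_derive (fun x => f x - g x) a (l - m).
Proof.
  intros hf hg; unfold is_left_derive in *.
  apply filterlim_ext with (fun x => (f x - f a) / (x - a) - (g x - g a) / (x - a)).
  - intros x; unfold Rdiv; ring.
  - now apply filterlim_Rminus.
Qed.

Lemma is_left_derive_of_is_derive (f : R -> R) (a l : R) :
  is_derive f a l -> is_left_derive f a l.
Proof.
  intros hf; apply is_derive_Reals in hf; apply filterlim_locally; intros e.
  destruct (hf e (cond_pos e)) as [d hd]; exists d; intros x hx hxa.
  change (Rabs ((f x - f a) / (x - a) - l) < e).
  replace (f x) with (f (a + (x - a))) by (f_equal; ring).
  apply hd; [lra | exact hx].
Qed.

(** Because [f s = 0], the hypothesis bounds the difference quotient at [s - m] by [K] in absolute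
    value, while for small [m] that quotient is close to [l]. *)
Lemma left_derive_le (f : R -> R) (s l K : R) :
  0 < s -> is_left_derive f s l -> f s = 0 ->
  (forall x, 0 < x < s -> Rabs (f x) <= K * (s - x)) -> Rabs l <= K.
Proof.
  intros hs hl h0 hK; destruct (Rle_or_lt (Rabs l) K) as [h|h]; [exact h|exfalso].
  assert (he : 0 < Rabs l - K) by lra.
  destruct (proj1 (filterlim_locally _ _) hl (mkposreal _ he)) as [d hd]; simpl in hd.
  pose (m := Rmin (d / 2) (s / 2)); pose proof (cond_pos d).
  assert (0 < m) by (apply Rmin_pos; lra).
  assert (m <= d / 2) by apply Rmin_l; assert (m <= s / 2) by apply Rmin_r.
  assert (hball : ball s d (s - m)).
  { change (Rabs (s - m - s) < d); apply Rabs_def1; lra. }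
  specialize (hd (s - m) hball ltac:(lra)).
  change (Rabs ((f (s - m) - f s) / (s - m - s) - l) < Rabs l - K) in hd.
  specialize (hK (s - m) ltac:(lra)).
  rewrite h0 in hd; replace ((f (s - m) - 0) / (s - m - s)) with (- (f (s - m) / m)) in hd
    by (field; lra).
  assert (h1 : Rabs (f (s - m) / m) <= K).
  { unfold Rdiv; rewrite Rabs_mult, (Rabs_right (/ m)) by (apply Rle_ge, Rlt_le, Rinv_0_lt_compat; lra).
    apply Rmult_le_reg_r with m; [lra|]; rewrite Rmult_assoc, Rinv_l by lra; lra. }
  pose proof (Rabs_triang_inv l (- (f (s - m) / m))) as h2.
  rewrite Rabs_minus_sym in h2; rewrite Rabs_Ropp in h2; lra.
Qed.

(** Supplies the constant that puts the profile at time 1 below the barrier. Boundedness alone is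
    not enough, since the parabola vanishes at [L]; the left derivative gives the linear decay
    there. *)
Lemma bound_by_parabola (f : R -> R) (L l : R) :
  0 < L ->
  (forall x, 0 <= x <= L ->
     filterlim f (within (fun y => 0 <= y <= L) (locally x)) (locally (f x))) ->
  f L = 0 -> is_left_derive f L l ->
  exists C, 0 < C /\ forall x, 0 <= x <= L -> Rabs (f x) <= C * (L ^ 2 - x ^ 2).
Proof.
  intros hL hf h0 hl.
  assert (hM : exists M, 0 <= M /\ forall x, 0 <= x <= L -> Rabs (f x) <= M).
  { destruct (continuity_ab_maj (fun x => Rabs (f (clamp 0 L x))) 0 L ltac:(lra)) as [X [hX _]].
    - intros x _; apply continuity_pt_filterlim.
      apply (filterlim_comp _ _ _ (fun x => f (clamp 0 L x)) Rabs _ (locally (f (clamp 0 L x))));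
        [|apply (filterlim_norm (V := R_NormedModule))].
      apply (filterlim_comp _ _ _ (clamp 0 L) f _
        (within (fun y => 0 <= y <= L) (locally (clamp 0 L x)))).
      + intros P hP; unfold filtermap.
        apply (filter_imp (fun y => 0 <= clamp 0 L y <= L -> P (clamp 0 L y))).
        * intros y hy; apply hy, clamp_range; lra.
        * exact (clamp_continuous 0 L x _ hP).
      + apply hf, clamp_range; lra.
    - exists (Rabs (f (clamp 0 L X))); split; [apply Rabs_pos|].
      intros x hx; specialize (hX x hx); rewrite (clamp_id 0 L x hx) in hX; exact hX. }
  destruct hM as [M [hM0 hM]].
  destruct (proj1 (filterlim_locally _ _) hl (mkposreal 1 Rlt_0_1)) as [d hd]; simpl in hd.
  pose proof (cond_pos d) as hdp; pose proof (Rabs_pos l) as hlp.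
  assert (hMd : 0 <= M / d) by (apply Rdiv_le_0_compat; lra).
  (* [Rabs l + 1] serves within distance [d] of [L], and [M / d] serves where [L - x >= d]. *)
  set (K := Rabs l + 1 + M / d).
  assert (hK : forall x, 0 <= x <= L -> Rabs (f x) <= K * (L - x)).
  { intros x hx; destruct (Req_dec x L) as [->|hxL].
    { rewrite h0, Rabs_R0; lra. }
    destruct (Rlt_or_le (L - d) x) as [hc|hc].
    - assert (hb : ball L d x) by (change (Rabs (x - L) < d); apply Rabs_def1; lra).
      specialize (hd x hb ltac:(lra)).
      change (Rabs ((f x - f L) / (x - L) - l) < 1) in hd.
      assert (h1 : Rabs ((f x - f L) / (x - L)) <= Rabs l + 1).
      { pose proof (Rabs_triang_inv ((f x - f L) / (x - L)) l); lra. }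
      replace (f x) with ((f x - f L) / (x - L) * (x - L)) by (rewrite h0; field; lra).
      rewrite Rabs_mult, (Rabs_left (x - L)) by lra.
      replace (- (x - L)) with (L - x) by ring.
      apply Rmult_le_compat_r; unfold K; lra.
    - apply Rle_trans with M; [now apply hM|].
      apply Rle_trans with (M / d * d); [right; field; lra|].
      apply Rle_trans with (M / d * (L - x)); [apply Rmult_le_compat_l; lra|].
      apply Rmult_le_compat_r; unfold K; lra. }
  assert (hK0 : 0 < K) by (unfold K; lra).
  (* [L ^ 2 - x ^ 2 = (L - x) * (L + x)] and [L + x >= L]. *)
  exists (K / L); split; [now apply Rdiv_lt_0_compat|].
  intros x hx; apply Rle_trans with (1 := hK x hx).
  replace (L ^ 2 - x ^ 2) with ((L - x) * (L + x)) by ring.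
  replace (K / L * ((L - x) * (L + x))) with (K * (L - x) * ((L + x) / L)) by (field; lra).
  rewrite <- (Rmult_1_r (K * (L - x))) at 1.
  apply Rmult_le_compat_l; [apply Rmult_le_pos; lra|].
  apply Rmult_le_reg_r with L; [lra|].
  unfold Rdiv; rewrite Rmult_assoc, Rinv_l; lra.
Qed.

(** Applying [heat_solution_decay] to [U] and to [- U] bounds the absolute value of [U] by
    [C * barrier]. Both vanish at the interface, where the barrier has slope of size
    [2 * L * t^(-lam) / sqrt t]; hence [sqrt t * Rabs l] is at most [2 * L * C * t^(-lam)]. *)
Lemma heat_flux_decay (a L : R) (U : R -> R -> R) (l1 : R) :
  0 < a -> 0 < L ->
  (forall x t, 1 <= t -> 0 <= x <= L * sqrt t ->
    filterlim (fun p => U (fst p) (snd p))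
     (within (fun p : R * R => 0 < snd p /\ 0 <= fst p <= L * sqrt (snd p)) (locally (x, t)))
     (locally (U x t))) ->
  (forall x t, 1 < t -> 0 < x < L * sqrt t -> exists (p : R -> R) (q : R),
     is_derive (fun u => U x u) t (a * q) /\
     locally x (fun y => is_derive (fun z => U z t) y (p y)) /\ is_derive p x q) ->
  (forall t, 1 <= t -> U 0 t = 0) ->
  (forall t, 1 <= t -> U (L * sqrt t) t = 0) ->
  is_left_derive (fun x => U x 1) L l1 ->
  forall eta, 0 < eta -> exists N, 1 <= N /\ forall t l, N <= t ->
    is_left_derive (fun x => U x t) (L * sqrt t) l -> sqrt t * Rabs l < eta.
Proof.
  intros ha hL hcont heq h0 hs hl1 eta heta.
  destruct (bound_by_parabola (fun x => U x 1) L l1 hL) as [C [hC hbound]]; auto.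
  { intros x hx; specialize (hcont x 1 (Rle_refl 1)); rewrite sqrt_1, Rmult_1_r in hcont.
    apply (filterlim_comp _ _ _ (fun y => (y, 1)) (fun p => U (fst p) (snd p)) _ _ _)
      with (2 := hcont hx).
    intros P [e he]; exists e; intros y hy hyL.
    apply he; [split; [exact hy | apply ball_center]|].
    simpl; rewrite sqrt_1, Rmult_1_r; split; [lra | exact hyL]. }
  { specialize (hs 1 (Rle_refl 1)); now rewrite sqrt_1, Rmult_1_r in hs. }
  (* Any exponent strictly between [0] and [2 * a / L ^ 2] would do; this is the midpoint. *)
  set (lam := a / L ^ 2).
  assert (hL2 : 0 < L ^ 2) by (apply pow_lt; lra).
  assert (hlam : 0 < lam) by (now apply Rdiv_lt_0_compat).
  assert (hlamL : lam * L ^ 2 < 2 * a) by (replace (lam * L ^ 2) with a by (unfold lam; field; lra); lra).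
  assert (hU : forall x t, 1 <= t -> 0 <= x <= L * sqrt t -> Rabs (U x t) <= C * barrier lam L x t).
  { intros x t ht hx; apply Rabs_le; split.
    - apply Ropp_le_cancel; rewrite Ropp_involutive.
      apply (heat_solution_decay a L lam C (fun x t => - U x t)); auto; try lra.
      + intros y u hu hy.
        apply (filterlim_comp _ _ _ (fun p => U (fst p) (snd p)) Ropp _ _ _ (hcont y u hu hy)).
        apply (filterlim_opp (V := R_NormedModule)).
      + intros y u hu hy; destruct (heq y u hu hy) as (p & q & e1 & e2 & e3).
        exists (fun z => - p z), (- q); split; [|split].
        * rewrite <- Ropp_mult_distr_r; exact (is_derive_opp (fun u => U y u) u (a * q) e1).
        * revert e2; apply filter_imp; intros z hz.
          exact (is_derive_opp (fun z => U z u) z (p z) hz).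
        * exact (is_derive_opp p y q e3).
      + intros u hu; rewrite h0 by exact hu; ring.
      + intros u hu; rewrite hs by exact hu; ring.
      + intros y hy; specialize (hbound y hy); pose proof (Rle_abs (- U y 1)) as h.
        rewrite Rabs_Ropp in h; lra.
    - apply (heat_solution_decay a L lam C U); auto; try lra.
      intros y hy; specialize (hbound y hy); pose proof (Rle_abs (U y 1)); lra. }
  assert (heta' : 0 < eta / (2 * L * C)).
  { apply Rdiv_lt_0_compat; [lra|]; repeat apply Rmult_lt_0_compat; lra. }
  (* The exponential solves [t^(-lam) = eta / (2 * L * C)]. Adding 1 makes the inequality strict and
     the bound at least 1. *)
  exists (1 + exp (- ln (eta / (2 * L * C)) / lam)).
  pose proof (exp_pos (- ln (eta / (2 * L * C)) / lam)) as hexp.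
  split; [lra|]; intros t l ht hl.
  assert (hst : 0 < sqrt t) by (apply sqrt_lt_R0; lra).
  assert (ht2 : t = sqrt t * sqrt t) by (rewrite sqrt_sqrt; lra).
  assert (hbeta : exp (- lam * ln t) < eta / (2 * L * C)).
  { rewrite <- (exp_ln _ heta') at 1; apply exp_increasing.
    assert (hln : - ln (eta / (2 * L * C)) / lam < ln t).
    { rewrite <- (ln_exp (- ln _ / lam)); apply ln_increasing; lra. }
    apply Rmult_lt_compat_r with (r := lam) in hln; [|exact hlam].
    replace (- ln (eta / (2 * L * C)) / lam * lam) with (- ln (eta / (2 * L * C))) in hln
      by (field; lra).
    lra. }
  set (be := exp (- lam * ln t)) in *.
  assert (hbe : 0 < be) by apply exp_pos.
  assert (hl' : Rabs l <= C * be * (2 * L / sqrt t)).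
  { apply (left_derive_le (fun x => U x t) (L * sqrt t)); auto.
    - now apply Rmult_lt_0_compat.
    - apply hs; lra.
    - intros x hx; apply Rle_trans with (1 := hU x t ltac:(lra) ltac:(lra)).
      unfold barrier; fold be.
      (* The factor [L * sqrt t - x] is the distance to the interface; the cofactor
         [(L * sqrt t + x) / t] is at most [2 * L / sqrt t]. *)
      replace (C * (be * (L ^ 2 - x ^ 2 / t)))
        with (C * be * (L * sqrt t - x) * ((L * sqrt t + x) / t)) by
        (clear - ht2 hst; revert ht2 hst; generalize (sqrt t); intros w -> hw; field; lra).
      rewrite (Rmult_assoc (C * be) (2 * L / sqrt t)), (Rmult_comm (2 * L / sqrt t)),
        <- (Rmult_assoc (C * be)).
      apply Rmult_le_compat_l.
      + repeat apply Rmult_le_pos; lra.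
      + replace (2 * L / sqrt t) with ((2 * (L * sqrt t)) / t) by
          (clear - ht2 hst; revert ht2 hst; generalize (sqrt t); intros w -> hw; field; lra).
        apply Rmult_le_compat_r; [apply Rlt_le, Rinv_0_lt_compat; lra | lra]. }
  apply Rle_lt_trans with (sqrt t * (C * be * (2 * L / sqrt t))).
  - apply Rmult_le_compat_l; lra.
  - replace (sqrt t * (C * be * (2 * L / sqrt t))) with (be * (2 * L * C)) by (field; lra).
    apply Rmult_lt_compat_r with (r := 2 * L * C) in hbeta; [|repeat apply Rmult_lt_0_compat; lra].
    replace (eta / (2 * L * C) * (2 * L * C)) with eta in hbeta by (field; lra); exact hbeta.
Qed.

(** Both limits are given, so a single mean value on [[u, 2 * u]] suffices. It will be applied to
    [r (u ^ 2)], where the equality of the limits becomes the equation for the coefficient. *)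
Lemma limit_ratio_eq_limit_derivative (f d : R -> R) (l m : R) :
  (forall u, 0 < u -> is_derive f u (d u)) ->
  is_lim (fun u => f u / u) p_infty l -> is_lim d p_infty m -> l = m.
Proof.
  intros hf hl hm; destruct (Req_dec l m) as [h|h]; [exact h|exfalso].
  assert (he : 0 < Rabs (l - m) / 4).
  { assert (0 < Rabs (l - m)) by (apply Rabs_pos_lt; lra); lra. }
  apply is_lim_spec in hl; apply is_lim_spec in hm.
  destruct (hl (mkposreal _ he)) as [M1 h1]; destruct (hm (mkposreal _ he)) as [M2 h2].
  simpl in h1, h2.
  set (e := Rabs (l - m) / 4) in *.
  set (u := Rmax (Rmax M1 M2) 0 + 1).
  assert (M1 < u /\ M2 < u /\ 0 < u) as (hu1 & hu2 & hu0).
  { pose proof (Rmax_l (Rmax M1 M2) 0); pose proof (Rmax_r (Rmax M1 M2) 0).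
    pose proof (Rmax_l M1 M2); pose proof (Rmax_r M1 M2); unfold u; lra. }
  (* [f (2 u) - f u = u d(c)] forces [2 l - l = m]. *)
  destruct (MVT_cor2 f d u (2 * u)) as [c [hc1 hc2]]; [lra| |].
  { intros c hc; apply is_derive_Reals, hf; lra. }
  assert (b1 := h1 u hu1); assert (b2 := h1 (2 * u) ltac:(lra)); assert (b3 := h2 c ltac:(lra)).
  apply Rabs_def2 in b1; apply Rabs_def2 in b2; apply Rabs_def2 in b3.
  assert (hd : d c = 2 * (f (2 * u) / (2 * u)) - f u / u).
  { apply Rmult_eq_reg_r with u; [|lra].
    replace ((2 * (f (2 * u) / (2 * u)) - f u / u) * u) with (f (2 * u) - f u) by (field; lra).
    rewrite hc1; ring. }
  assert (Rabs (l - m) < 4 * e) by (apply Rabs_def1; lra).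
  unfold e in H; lra.
Qed.

(** * Asymptotics of the two-free-boundary problem *)

Lemma is_derive_affine (f : R -> R) (K m x l : R) :
  is_derive f x l -> is_derive (fun y => K * f y - m) x (K * l).
Proof.
  intros hf; rewrite <- (Rminus_0_r (K * l)).
  apply (is_derive_Rminus (fun y => K * f y)); [now apply is_derive_scal|].
  apply (@is_derive_const R_AbsRing R_NormedModule).
Qed.

Lemma erf_similarity_continuous (a x t : R) : 0 < a -> 0 < t ->
  continuous (fun p : R * R => erf (fst p / (2 * sqrt (a * snd p)))) (x, t).
Proof.
  intros ha ht; assert (hat : 0 < a * t) by now apply Rmult_lt_0_compat.
  pose proof (sqrt_lt_R0 _ hat).
  apply (continuous_comp (fun p : R * R => fst p / (2 * sqrt (a * snd p))) erf).
  - apply (continuous_mult (K := R_AbsRing) (fun p : R * R => fst p)); [apply continuous_fst|].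
    apply (continuous_comp (fun p : R * R => snd p) (fun u => / (2 * sqrt (a * u))));
      [apply continuous_snd|].
    apply (ex_derive_continuous (fun u => / (2 * sqrt (a * u)))); simpl; auto_derive.
    repeat split; lra.
  - apply (ex_derive_continuous erf); eexists; apply is_derive_erf.
Qed.

(** By the last interface condition [gamma / (r - s)] is the left derivative of [T] at the
    interface, so with [u = sqrt t] this is the limit of [sqrt t * T_x]. It follows from
    [heat_flux_decay] for [U = T - Z]. *)
Lemma solves_P2_flux_limit (k rho c ell gamma eps D0 : R) (T : R -> R -> R) (s r : R -> R)
  (xi : R) (a := k / (rho * c)) :
  0 < a -> 0 < xi -> solves_P2 k rho c ell gamma eps D0 T s r ->
  (forall t, 0 < t -> s t = 2 * xi * sqrt (a * t)) ->
  is_lim (fun u => u * (gamma / (r (u ^ 2) - s (u ^ 2)))) p_infty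
    (D0 / erf xi * (exp (- xi ^ 2) / sqrt (PI * a))).
Proof.
  intros ha hxi hP hs.
  pose proof (erf_pos xi hxi) as hexi; pose proof (sqrt_lt_R0 a ha) as hsa.
  set (L := 2 * xi * sqrt a); set (K := D0 / erf xi).
  assert (hL : 0 < L) by (unfold L; repeat apply Rmult_lt_0_compat; lra).
  assert (hsL : forall t, 0 < t -> s t = L * sqrt t).
  { intros t ht; rewrite hs, sqrt_mult by lra; unfold L; ring. }
  assert (hself : forall t, 0 < t -> L * sqrt t / (2 * sqrt (a * t)) = xi).
  { intros t ht; pose proof (sqrt_lt_R0 t ht); rewrite sqrt_mult by lra; unfold L; field; lra. }
  (* [Z] has the lateral data of [T]: [- D0] at [x = 0], and, by [hself] and the choice of [K], zero
     on the interface. *)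
  set (Z := fun x t => K * erf (x / (2 * sqrt (a * t))) - D0).
  assert (hZl : forall t, 0 < t -> is_left_derive (fun x => Z x t) (L * sqrt t)
      (K * (exp (- xi ^ 2) / sqrt (PI * a)) / sqrt t)).
  { intros t ht; apply is_left_derive_of_is_derive.
    replace (K * (exp (- xi ^ 2) / sqrt (PI * a)) / sqrt t)
      with (K * (exp (- xi ^ 2) / sqrt (PI * (a * t)))).
    - rewrite <- (hself t ht); apply is_derive_affine, erf_similarity_x; assumption.
    - pose proof PI_RGT_0; assert (0 < PI * a) by now apply Rmult_lt_0_compat.
      rewrite <- Rmult_assoc, (sqrt_mult (PI * a)) by lra.
      field; split; apply Rgt_not_eq, sqrt_lt_R0; assumption. }
  assert (hTl : forall t, 0 < t ->
      is_left_derive (fun x => T x t) (L * sqrt t) (gamma / (r t - s t))).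
  { intros t ht; destruct (P2_flux _ _ _ _ _ _ _ _ _ _ hP t ht) as (Tx & h1 & _ & h3).
    pose proof (P2_order _ _ _ _ _ _ _ _ _ _ hP t ht).
    rewrite <- hsL by exact ht; replace (gamma / (r t - s t)) with Tx; [exact h1|].
    rewrite <- h3; field; lra. }
  set (U := fun x t => T x t - Z x t).
  assert (hUl : forall t, 0 < t -> is_left_derive (fun x => U x t) (L * sqrt t)
      (gamma / (r t - s t) - K * (exp (- xi ^ 2) / sqrt (PI * a)) / sqrt t)).
  { intros t ht; apply is_left_derive_minus; auto. }
  apply is_lim_spec; intros e.
  destruct (heat_flux_decay a L U (gamma / (r 1 - s 1) - K * (exp (- xi ^ 2) / sqrt (PI * a)) / sqrt 1)
    ha hL) with (eta := pos e) as [N [hN hdecay]]; try apply cond_pos.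
  - intros x t ht hx; unfold U.
    apply (filterlim_Rminus (fun p : R * R => T (fst p) (snd p)) (fun p : R * R => Z (fst p) (snd p))).
    + assert (hsol : solid s (x, t)) by (split; simpl; [|rewrite hsL]; lra).
      eapply filterlim_filter_le_1; [|exact (P2_T_cont _ _ _ _ _ _ _ _ _ _ hP x t hsol)].
      intros P hP'; unfold within in *; revert hP'; apply filter_imp.
      intros p hp [hp1 hp2]; apply hp; split; [exact hp1|]; now rewrite hsL.
    + eapply filterlim_filter_le_1; [apply filter_le_within|].
      apply (filterlim_Rminus (fun p : R * R => K * erf (fst p / (2 * sqrt (a * snd p)))) (fun _ => D0));
        [|apply filterlim_const].
      exact (continuous_mult (K := R_AbsRing) (fun _ => K) _ (x, t) (continuous_const _ _)
        (erf_similarity_continuous a x t ha ltac:(lra))).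
  - intros x t ht hx; assert (ht0 : 0 < t) by lra; rewrite <- hsL in hx by exact ht0.
    destruct (P2_T_diff _ _ _ _ _ _ _ _ _ _ hP x t ht0 hx) as (d1 & _ & d3).
    pose proof (P2_heat _ _ _ _ _ _ _ _ _ _ hP x t ht0 hx) as hheat; fold a in hheat.
    exists (fun z => Derive (fun y => T y t) z -
      K * (exp (- (z / (2 * sqrt (a * t))) ^ 2) / sqrt (PI * (a * t)))).
    exists (Derive (Derive (fun y => T y t)) x -
      K * (- x / (2 * (a * t)) * exp (- (x / (2 * sqrt (a * t))) ^ 2) / sqrt (PI * (a * t)))).
    split; [|split].
    + match goal with |- is_derive _ _ (a * (?v - K * ?w)) =>
        replace (a * (v - K * w)) with (Derive (fun u => T x u) t - K * (a * w))
          by (replace (Derive (fun u => T x u) t) with (a * v) by lra; ring) end.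
      apply (is_derive_Rminus (fun u => T x u)); [apply Derive_correct, d1|].
      apply is_derive_affine, erf_similarity_t; assumption.
    (* Differentiability of [T] is given only strictly inside the solid, which is an open condition
       on [z]. *)
    + assert (hloc : locally x (fun z => 0 < z < s t)).
      { apply (open_and (fun z => 0 < z) (fun z => z < s t)); [apply open_gt | apply open_lt | exact hx]. }
      revert hloc; apply filter_imp; intros z hz.
      apply (is_derive_Rminus (fun y => T y t)).
      * apply Derive_correct, (P2_T_diff _ _ _ _ _ _ _ _ _ _ hP z t ht0 hz).
      * apply is_derive_affine, erf_similarity_x; assumption.
    + apply (is_derive_Rminus (Derive (fun y => T y t))); [apply Derive_correct, d3|].
      apply is_derive_scal, erf_similarity_xx; assumption.
  - intros t ht; unfold U, Z.
    rewrite (P2_fixed_face _ _ _ _ _ _ _ _ _ _ hP) by lra.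
    unfold Rdiv at 1; rewrite Rmult_0_l, erf_0; ring.
  - intros t ht; unfold U, Z; rewrite hself, <- hsL by lra.
    rewrite (P2_interface _ _ _ _ _ _ _ _ _ _ hP) by lra; unfold K; field; lra.
  - specialize (hUl 1 Rlt_0_1); rewrite sqrt_1, Rmult_1_r in hUl; rewrite sqrt_1; exact hUl.
  - exists N; intros u hu.
    assert (hu2 : N <= u ^ 2).
    { apply Rle_trans with u; [lra|]; rewrite <- (pow_1 u) at 1; apply Rle_pow; [lra | auto]. }
    specialize (hdecay (u ^ 2) _ hu2 (hUl (u ^ 2) ltac:(lra))).
    rewrite sqrt_pow2 in hdecay by lra.
    rewrite <- (Rabs_right u) in hdecay at 1 by lra; rewrite <- Rabs_mult in hdecay.
    match goal with |- Rabs ?v < _ => replace v with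
      (u * (gamma / (r (u ^ 2) - s (u ^ 2)) - K * (exp (- xi ^ 2) / sqrt (PI * a)) / u)) end;
      [exact hdecay | simpl; unfold K].
    pose proof (P2_order _ _ _ _ _ _ _ _ _ _ hP (u ^ 2) ltac:(lra)) as ho; simpl in ho.
    pose proof PI_RGT_0; assert (0 < PI * a) by now apply Rmult_lt_0_compat.
    field; repeat split; try lra; apply Rgt_not_eq, sqrt_lt_R0; assumption.
Qed.

Lemma solves_P2_interface_coefficient (k rho c ell gamma eps D0 : R) (T : R -> R -> R)
  (s r : R -> R) (xi : R) (a := k / (rho * c))
  (h := D0 / erf xi * (exp (- xi ^ 2) / sqrt (PI * a))) :
  0 < k -> 0 < rho -> 0 < c -> 0 < ell -> 0 < eps < 1 -> 0 < D0 -> 0 < xi ->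
  solves_P2 k rho c ell gamma eps D0 T s r ->
  (forall t, 0 < t -> s t = 2 * xi * sqrt (a * t)) ->
  2 * xi * sqrt a + gamma * (1 - eps) / h = 2 * k * h / (rho * ell).
Proof.
  intros hk hrho hc hell heps hD0 hxi hP hs.
  assert (ha : 0 < a) by (apply Rdiv_lt_0_compat; [|apply Rmult_lt_0_compat]; assumption).
  assert (hz := solves_P2_flux_limit k rho c ell gamma eps D0 T s r xi ha hxi hP hs).
  fold a h in hz; set (z := fun u => u * (gamma / (r (u ^ 2) - s (u ^ 2)))) in hz.
  set (L := 2 * xi * sqrt a).
  assert (hh : 0 < h).
  { unfold h; apply Rmult_lt_0_compat; apply Rdiv_lt_0_compat; try lra.
    - now apply erf_pos.
    - apply exp_pos.
    - apply sqrt_lt_R0, Rmult_lt_0_compat; [apply PI_RGT_0 | exact ha]. }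
  assert (hsL : forall t, 0 < t -> s t = L * sqrt t).
  { intros t ht; rewrite hs, sqrt_mult by lra; unfold L; ring. }
  (* If [gamma] were zero, [z] would vanish identically, against its positive limit [h]. *)
  assert (hg : gamma <> 0).
  { intros hg; assert (e : Finite h = Finite 0); [|injection e; lra].
    rewrite <- (is_lim_unique _ _ _ hz); rewrite <- (Lim_const 0 p_infty).
    apply Lim_ext; intros u; unfold z; rewrite hg; unfold Rdiv; ring. }
  assert (hu2 : forall u, 0 < u -> 0 < u ^ 2) by (intros; now apply pow_lt).
  assert (hl : is_lim (fun u => r (u ^ 2) / u) p_infty (L + gamma / h)).
  { apply is_lim_ext_loc with (fun u => L + gamma * / z u).
    - exists 0; intros u hu; unfold z.
      pose proof (P2_order _ _ _ _ _ _ _ _ _ _ hP _ (hu2 u hu)) as ho.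
      replace (r (u ^ 2)) with (s (u ^ 2) + (r (u ^ 2) - s (u ^ 2))) at 2 by ring.
      rewrite (hsL (u ^ 2)) at 2 by auto; rewrite sqrt_pow2 by lra.
      field; repeat split; lra.
    - apply (is_lim_plus _ _ _ L (gamma / h)); [apply is_lim_const | | reflexivity].
      apply (is_lim_scal_l (fun u => / z u) gamma p_infty (/ h)).
      apply (is_lim_inv z p_infty h hz); intros e; injection e; lra. }
  assert (hm : is_lim (fun u => (2 * k / (rho * ell) * z u - eps * L) / (1 - eps)) p_infty
      ((2 * k / (rho * ell) * h - eps * L) / (1 - eps))).
  { apply (is_lim_scal_r (fun u => 2 * k / (rho * ell) * z u - eps * L) (/ (1 - eps)) p_infty
      (2 * k / (rho * ell) * h - eps * L)).
    apply (is_lim_minus _ _ _ (2 * k / (rho * ell) * h) (eps * L)); [|apply is_lim_const | reflexivity].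
    apply (is_lim_scal_l z _ p_infty h hz). }
  (* [u] stands for [sqrt t]: the derivative of [u |-> r (u ^ 2)] is [2 sqrt t r'(t)]. *)
  assert (e : L + gamma / h = (2 * k / (rho * ell) * h - eps * L) / (1 - eps)).
  { refine (limit_ratio_eq_limit_derivative (fun u => r (u ^ 2)) _ _ _ _ hl hm).
    intros u hu.
    destruct (P2_flux _ _ _ _ _ _ _ _ _ _ hP _ (hu2 u hu)) as (Tx & _ & h2 & h3).
    pose proof (P2_order _ _ _ _ _ _ _ _ _ _ hP _ (hu2 u hu)) as ho.
    assert (hTx : Tx = gamma / (r (u ^ 2) - s (u ^ 2))) by (rewrite <- h3; field; lra).
    assert (hds : Derive s (u ^ 2) = L / (2 * u)).
    { apply is_derive_unique.
      apply is_derive_ext_loc with (fun t => L * sqrt t).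
      - assert (hloc : locally (u ^ 2) (fun t => 0 < t)) by (apply open_gt; auto).
        revert hloc; apply filter_imp; intros t ht; symmetry; now apply hsL.
      - pose proof (hu2 u hu); auto_derive; [exact H|].
        rewrite <- (Rmult_1_r u) at 2; fold (u ^ 2); rewrite sqrt_pow2 by lra; field; lra. }
    (* Multiplying the flux condition by [2 * u / (rho * ell)] and using [s' = L / (2 * u)] gives [2
       * k / (rho * ell) * z u = eps * L + (1 - eps) * (2 * u * r')]. *)
    replace ((2 * k / (rho * ell) * z u - eps * L) / (1 - eps)) with (2 * u * Derive r (u ^ 2)).
    - apply (is_derive_comp r (fun v => v ^ 2)).
      + apply Derive_correct, (P2_r_diff _ _ _ _ _ _ _ _ _ _ hP); auto.
      + auto_derive; [exact I | ring].
    - rewrite hds, hTx in h2.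
      assert (hz' : z u = u * (gamma / (r (u ^ 2) - s (u ^ 2)))) by reflexivity.
      replace (2 * k / (rho * ell) * z u)
        with (2 * u / (rho * ell) * (k * (gamma / (r (u ^ 2) - s (u ^ 2)))))
        by (rewrite hz'; field; repeat split; lra).
      rewrite h2; field; repeat split; lra. }
  (* After clearing [1 - eps], the terms [(1 - eps) * L] and [eps * L] add up to [L]. *)
  apply (f_equal (fun v => v * (1 - eps))) in e.
  replace ((2 * k / (rho * ell) * h - eps * L) / (1 - eps) * (1 - eps))
    with (2 * k * h / (rho * ell) - eps * L) in e by (field; repeat split; lra).
  replace (gamma * (1 - eps) / h) with (gamma / h * (1 - eps)) by (field; lra).
  lra.
Qed.

(** * Identification of [xi] with [omega], and the inequality *)

Theorem corollary8
  (k rho c ell gamma q0 eps : R)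
  (hk : 0 < k) (hrho : 0 < rho) (hc : 0 < c) (hell : 0 < ell)
  (hgamma : 0 < gamma) (hq0 : 0 < q0) (heps : 0 < eps < 1)
  (hq0_large : q0 > sqrt (gamma * (1 - eps) * rho * ell * k / 2))
  (D0 : R) (hD0 : is_datum_of_flux k rho c ell gamma eps q0 D0)
  (T : R -> R -> R) (s r : R -> R)
  (hP2 : solves_P2 k rho c ell gamma eps D0 T s r)
  (xi : R) (hxi : 0 < xi)
  (hs : forall t, 0 < t -> s t = 2 * xi * sqrt (k / (rho * c) * t)) :
  erf xi < D0 * sqrt (2 * c / (PI * gamma * (1 - eps) * ell)).
Proof.
  destruct hD0 as (om & [[hom homeq] _] & hD0).
  pose proof PI_RGT_0 as hpi.
  set (a := k / (rho * c)) in *.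
  assert (ha : 0 < a) by (apply Rdiv_lt_0_compat; [|apply Rmult_lt_0_compat]; assumption).
  assert (hsa := sqrt_lt_R0 a ha).
  assert (hpa : 0 < sqrt (PI * a)) by (apply sqrt_lt_R0, Rmult_lt_0_compat; assumption).
  pose proof (erf_pos xi hxi) as hexi; pose proof (erf_pos om hom) as heom.
  assert (hD0pos : 0 < D0).
  { rewrite hD0; apply Rmult_lt_0_compat; [|exact heom].
    apply Rdiv_lt_0_compat; [apply Rmult_lt_0_compat|]; assumption. }
  assert (hqo : 0 < q0 / k * erf om)
    by (apply Rmult_lt_0_compat; [apply Rdiv_lt_0_compat|]; assumption).
  (* [flux xi] is [h] of [solves_P2_interface_coefficient], and
     [flux om = q0 / k * exp (- om ^ 2)]. *)
  set (flux := fun x => q0 / k * erf om * (exp (- x ^ 2) / erf x)).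
  assert (hfpos : forall x, 0 < x -> 0 < flux x).
  { intros x hx; pose proof (erf_pos x hx); pose proof (exp_pos (- x ^ 2)).
    unfold flux; apply Rmult_lt_0_compat; [exact hqo | now apply Rdiv_lt_0_compat]. }
  assert (hfdecr : forall x y, 0 < x < y -> flux y < flux x).
  { intros x y hxy; pose proof (erf_pos x ltac:(lra)); pose proof (erf_increasing x y ltac:(lra)).
    apply Rmult_lt_compat_l.
    - exact hqo.
    - apply Rmult_gt_0_lt_compat; try apply exp_pos.
      + apply Rinv_0_lt_compat; lra.
      + apply exp_increasing, Ropp_lt_contravar; simpl; rewrite !Rmult_1_r.
        apply Rmult_gt_0_lt_compat; lra.
      + apply Rinv_lt_contravar; [apply Rmult_lt_0_compat; lra | lra]. }
  assert (hxi_eq : 2 * xi * sqrt a + gamma * (1 - eps) / flux xi = 2 * k * flux xi / (rho * ell)).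
  { replace (flux xi) with (D0 / erf xi * (exp (- xi ^ 2) / sqrt (PI * a)))
      by (unfold flux; rewrite hD0; field; repeat split; lra).
    exact (solves_P2_interface_coefficient k rho c ell gamma eps D0 T s r xi
      hk hrho hc hell heps hD0pos hxi hP2 hs). }
  assert (hom_eq : 2 * om * sqrt a + gamma * (1 - eps) / flux om = 2 * k * flux om / (rho * ell)).
  { unfold omega_equation in homeq; cbv zeta in homeq; fold a in homeq.
    set (E := exp (om ^ 2)) in homeq.
    assert (hE : 0 < E) by apply exp_pos.
    replace (flux om) with (q0 / k * / E)
      by (unfold flux, E; rewrite <- exp_Ropp; field; lra).
    (* This factor brings the equation for [om] to the form of [hxi_eq], since
       [1 / flux om = k * E / q0]. *)
    apply (f_equal (fun v => v * (2 * sqrt a / E))) in homeq.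
    replace (2 * k * (q0 / k * / E) / (rho * ell))
      with (q0 / (rho * ell * sqrt a) * (2 * sqrt a / E)) by (field; repeat split; lra).
    rewrite <- homeq; field; repeat split; lra. }
  (* As [flux] decreases, the left side of the equation strictly increases and the right side
     strictly decreases, so two distinct positive solutions cannot exist. *)
  assert (hmono : forall x y, 0 < x < y ->
    2 * x * sqrt a + gamma * (1 - eps) / flux x = 2 * k * flux x / (rho * ell) ->
    2 * y * sqrt a + gamma * (1 - eps) / flux y = 2 * k * flux y / (rho * ell) -> False).
  { intros x y hxy hx hy; pose proof (hfdecr x y hxy) as hf.
    pose proof (hfpos x ltac:(lra)); pose proof (hfpos y ltac:(lra)).
    assert (2 * k * flux y / (rho * ell) < 2 * k * flux x / (rho * ell)).
    { apply Rmult_lt_compat_r.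
      - apply Rinv_0_lt_compat, Rmult_lt_0_compat; assumption.
      - apply Rmult_lt_compat_l; lra. }
    assert (gamma * (1 - eps) / flux x < gamma * (1 - eps) / flux y).
    { apply Rmult_lt_compat_l; [apply Rmult_lt_0_compat; lra|].
      apply Rinv_lt_contravar; [now apply Rmult_lt_0_compat | exact hf]. }
    assert (2 * x * sqrt a < 2 * y * sqrt a) by (apply Rmult_lt_compat_r; lra).
    lra. }
  assert (hxo : xi = om).
  { destruct (Rtotal_order xi om) as [h|[h|h]]; [exfalso | exact h | exfalso].
    - now apply (hmono xi om).
    - now apply (hmono om xi). }
  set (Q := gamma * (1 - eps) * rho * ell * k / 2) in *.
  assert (hge : 0 < gamma * (1 - eps)) by (apply Rmult_lt_0_compat; lra).
  assert (hQ : 0 < Q) by (unfold Q; repeat apply Rmult_lt_0_compat; lra).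
  assert (hsQ := sqrt_lt_R0 Q hQ).
  (* With this product and [xi = om], the right side of the goal is [erf om * (q0 / sqrt Q)], so
     what remains is [sqrt Q < q0]. *)
  assert (hprod : sqrt (PI * a) * sqrt (2 * c / (PI * gamma * (1 - eps) * ell)) = k / sqrt Q).
  { rewrite <- sqrt_mult_alt by (apply Rlt_le, Rmult_lt_0_compat; assumption).
    replace (PI * a * (2 * c / (PI * gamma * (1 - eps) * ell))) with (k ^ 2 / Q)
      by (unfold a, Q; field; repeat split; lra).
    rewrite sqrt_div_alt, sqrt_pow2 by lra; reflexivity. }
  rewrite hD0, hxo.
  replace (q0 * sqrt (PI * a) / k * erf om * sqrt (2 * c / (PI * gamma * (1 - eps) * ell)))
    with (erf om * (q0 / k * (sqrt (PI * a) * sqrt (2 * c / (PI * gamma * (1 - eps) * ell)))))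
    by (field; repeat split; lra).
  rewrite hprod, <- (Rmult_1_r (erf om)) at 1; apply Rmult_lt_compat_l; [exact heom|].
  replace (q0 / k * (k / sqrt Q)) with (q0 / sqrt Q) by (field; lra).
  apply Rmult_lt_reg_r with (sqrt Q); [exact hsQ|].
  replace (q0 / sqrt Q * sqrt Q) with q0 by (field; lra); lra.
Qed.
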